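(* The following properties are satisfied. (i) $\mu(\boldsymbol{x})\ge1$ for any $\boldsymbol{x}\in\mathcal{X}^n$. (ii) For any $\boldsymbol{x}\in\mathcal{X}^n$, $\mu(\boldsymbol{x})=\infty$ when $n<d$. (iii) For any $\boldsymbol{x}\in\mathcal{X}^n$, when $\operatorname{tr}(G^{\boldsymbol{x}})\ge d-1$, $$\mu(\boldsymbol{x})\le\Bigl(1-\sum_{j=1}^d\|(I-P_{\mathcal{V}_{\boldsymbol{x}}})b_j\|_{\mathcal{V}}^2\Bigr)^{-1/2}=\bigl(1-\operatorname{tr}(I-G^{\boldsymbol{x}})\bigr)^{-1/2}.$$ (iv) For every $\mu_\star>1$ there exist an $n\in\mathbb{N}$ and a sample $\boldsymbol{x}\in\mathcal{X}^n$ such that $\mu(\boldsymbol{x})\le\mu_\star$.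
   Context: $\mathcal{V}$ is a real reproducing kernel Hilbert space of functions on $\mathcal{X}$ with inner product $(\cdot,\cdot)_{\mathcal{V}}$, norm $\|\cdot\|_{\mathcal{V}}$ and reproducing kernel $k$; $\mathcal{V}_d\subseteq\mathcal{V}$ is a fixed $d$-dimensional subspace with $\mathcal{V}$-orthonormal basis $b_1,\dots,b_d$. For $\boldsymbol{x}=(x_1,\dots,x_n)\in\mathcal{X}^n$, $P_{\mathcal{V}_{\boldsymbol{x}}}$ is the $\mathcal{V}$-orthogonal projection onto $\mathcal{V}_{\boldsymbol{x}}:=\operatorname{span}\{k(x_1,\cdot),\dots,k(x_n,\cdot)\}$, $G^{\boldsymbol{x}}\in\mathbb{R}^{d\times d}$ is $G^{\boldsymbol{x}}_{jk}:=(P_{\mathcal{V}_{\boldsymbol{x}}}b_j,b_k)_{\mathcal{V}}$, and $\mu(\boldsymbol{x}):=\max_{0\ne v\in\mathcal{V}_d}\|v\|_{\mathcal{V}}/\|P_{\mathcal{V}_{\boldsymbol{x}}}v\|_{\mathcal{V}}\in(0,\infty]$ (equal to $\infty$ if $P_{\mathcal{V}_{\boldsymbol{x}}}v=0$ for some $0\ne v\in\mathcal{V}_d$). Convention: $0^{-1/2}=\infty$. *)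

(* Defs.v *)
From HB Require Import structures.
From mathcomp Require Import all_boot all_order all_algebra.
From mathcomp Require Import all_classical all_reals all_analysis.

Set Implicit Arguments.
Unset Strict Implicit.
Unset Printing Implicit Defensive.

Import Order.TTheory GRing.Theory Num.Theory.
Import numFieldNormedType.Exports.

Local Open Scope classical_set_scope.
Local Open Scope ring_scope.

(* A real reproducing kernel Hilbert space of functions on X.  Its elements
   are identified with functions X -> R through the injective linear
   evaluation map [rkhs_eval]; [rkhs_ker x] is the element k(x, .), so that
   the kernel is k(x, y) = rkhs_eval (rkhs_ker x) y.  Completeness is that of
   the carrier, whose norm is the one induced by the inner product. *)
Record rkhs (R : realType) (X : Type) := Rkhs {
  rkhs_car :> completeNormedModType R;
  rkhs_dot : {dot rkhs_car for idfun};
  rkhs_normE : forall v : rkhs_car, `|v| = Num.sqrt (rkhs_dot v v);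
  rkhs_eval : rkhs_car -> X -> R;
  rkhs_eval_linear : forall (a : R) (u v : rkhs_car) (x : X),
    rkhs_eval (a *: u + v) x = a * rkhs_eval u x + rkhs_eval v x;
  rkhs_eval_inj : injective rkhs_eval;
  rkhs_ker : X -> rkhs_car;
  rkhs_reproducing : forall (f : rkhs_car) (x : X),
    rkhs_dot f (rkhs_ker x) = rkhs_eval f x
}.

Definition lin_span (R : realType) (W : lmodType R) (n : nat)
    (w : 'I_n -> W) : set W :=
  [set v | exists c : 'I_n -> R, v = \sum_(i < n) c i *: w i].

Section Rkhs.
Variables (R : realType) (X : Type) (V : rkhs R X).

Local Notation dot := (rkhs_dot V).

Definition orthonormal_basis (d : nat) (b : 'I_d -> V) (W : set V) : Prop :=
  (forall i j : 'I_d, dot (b i) (b j) = (i == j)%:R) /\ W = lin_span b.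

(* The orthogonal projection of v onto W: the element p of W such that v - p
   is orthogonal to W.  It exists and is unique for the finite-dimensional
   subspaces W it is used for. *)
Definition orth_proj (W : set V) (v : V) : V :=
  get [set p | W p /\ forall w, W w -> dot (v - p) w = 0].

Definition sample_space (n : nat) (x : 'I_n -> X) : set V :=
  lin_span (fun i => rkhs_ker V (x i)).

Definition gram (d : nat) (b : 'I_d -> V) (n : nat) (x : 'I_n -> X) : 'M[R]_d :=
  \matrix_(j, k) dot (orth_proj (sample_space x) (b j)) (b k).

(* Division in \bar R: inve 0 = +oo, so the ratio is +oo when the projection
   of v vanishes. *)
Definition mu_ratios (Vd : set V) (n : nat) (x : 'I_n -> X) : set (\bar R) :=
  [set (`|v|%:E / `|orth_proj (sample_space x) v|%:E)%E
    | v in [set v | Vd v /\ v != 0]].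

(* The greatest element of the set of ratios; it exists when Vd is a nonzero
   finite-dimensional subspace. *)
Definition mu (Vd : set V) (n : nat) (x : 'I_n -> X) : \bar R :=
  get (mu_ratios Vd x `&` ubound (mu_ratios Vd x)).

End Rkhs.

Arguments sample_space {R X} V {n} x.

(* t^(-1/2) for t >= 0, equal to +oo at t = 0 since inve 0 = +oo. *)
Definition inv_sqrt (R : realType) (t : R) : \bar R :=
  (((Num.sqrt t)%:E)^-1)%E.

(* Main.v *)
Require Import Defs.
From HB Require Import structures.
From mathcomp Require Import all_boot all_order all_algebra.
From mathcomp Require Import all_classical all_reals all_analysis.
From mathcomp Require Import ring lra.

Import Order.TTheory GRing.Theory Num.Theory.
Import numFieldNormedType.Exports.

Local Open Scope classical_set_scope.
Local Open Scope ring_scope.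

(** Write [P] for the projection onto the sample space.  The ratio
    [|v| / |P v|] is homogeneous of degree 0, so it is governed by the function
    [v |-> |P v|] on the unit sphere of [Vd].  In coordinates with respect to
    the orthonormal basis [b] this sphere is the Euclidean unit sphere of
    ['rV_d], which is compact, and [P] is linear; hence [|P v|] has a minimum
    there, attained at some [v0], and [mu] is the inverse of [|P v0|]
    ([mu_minimizer]).  The four properties become statements on [|P v0|].

    - (i) A projection is a contraction, so [|P v0| <= 1].
    - (ii) If [n < d], the [n] linear conditions [v(x_i) = 0] have a nonzero
      solution in [Vd], on which [P] vanishes, so the minimum is 0
      ([exists_proj_eq0]).
    - (iii) [v0 - P v0] is the combination of the residuals [b_j - P b_j] with
      the coordinates of [v0], a unit vector, as coefficients.  By
      Cauchy-Schwarz its squared norm is at most the sum of the squared norms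
      of the residuals, and Pythagoras turns this into a lower bound on
      [|P v0|] ([sqr_norm_proj_ge]).  The sum is [tr (I - G)] because
      [|b_j - P b_j|^2 = 1 - (P b_j, b_j)] ([residual_gram]).
    - (iv) By the lower bound of (iii), it suffices to make all residuals
      small.  A function orthogonal to all kernel sections [k(x, .)] is zero
      everywhere by the reproducing property, so by completeness the kernel
      sections span a dense subspace ([sample_dense]).  Each [b_j] is thus
      approximated on some finite sample, and merging the [d] samples
      ([sample_join]) gives one that suits all of them. *)

Section Projection.
Context {R : realType} {X : Type} {V : rkhs R X}.

Local Notation dot := (rkhs_dot V).
Implicit Types (u v w p : V) (W : set V).

(** * Inner product *)

Lemma dotC u v : dot u v = dot v u.
Proof. by rewrite hermitian_subproof expr0 mul1r. Qed.

Lemma dotDl u v w : dot (u + v) w = dot u w + dot v w.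
Proof. exact: linearDl. Qed.

Lemma dotDr u v w : dot w (u + v) = dot w u + dot w v.
Proof. by rewrite dotC dotDl !(dotC _ w). Qed.

Lemma dotBl u v w : dot (u - v) w = dot u w - dot v w.
Proof. exact: linearBl. Qed.

Lemma dotBr u v w : dot w (u - v) = dot w u - dot w v.
Proof. by rewrite dotC dotBl !(dotC _ w). Qed.

Lemma dotZl (a : R) u w : dot (a *: u) w = a * dot u w.
Proof. exact: linearZl_LR. Qed.

Lemma dotZr (a : R) u w : dot w (a *: u) = a * dot w u.
Proof. by rewrite dotC dotZl dotC. Qed.

Lemma dot0l w : dot 0 w = 0.
Proof. exact: linear0l. Qed.

Lemma dot_suml (n : nat) (f : 'I_n -> V) w :
  dot (\sum_i f i) w = \sum_i dot (f i) w.
Proof. exact: linear_sumlz. Qed.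

Lemma dot_sumr (n : nat) (f : 'I_n -> V) w :
  dot w (\sum_i f i) = \sum_i dot w (f i).
Proof. by rewrite dotC dot_suml; apply: eq_bigr => i _; rewrite dotC. Qed.

Lemma sqr_norm v : `|v| ^+ 2 = dot v v.
Proof.
rewrite rkhs_normE sqr_sqrtr //.
by have [->|/neq0_dnorm_gt0/ltW//] := eqVneq v 0; rewrite dot0l.
Qed.

Lemma dot_eq0 v : dot v v = 0 -> v = 0.
Proof. by rewrite -sqr_norm => /eqP; rewrite expf_eq0 normr_eq0 => /eqP. Qed.

Lemma sqr_normB u v : `|u - v| ^+ 2 = `|u| ^+ 2 - 2 * dot u v + `|v| ^+ 2.
Proof. by rewrite !sqr_norm !(dotBl, dotBr) (dotC v u); ring. Qed.

Lemma sqr_normD_orth {u v} : dot u v = 0 ->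
  `|u + v| ^+ 2 = `|u| ^+ 2 + `|v| ^+ 2.
Proof. by move=> uv; rewrite !sqr_norm !(dotDl, dotDr) (dotC v u) uv; ring. Qed.

(** The value [t = (u, w) / |w|^2] minimizes the right hand side, where it
    equals [|u|^2 - (u, w)^2 / |w|^2]. *)
Lemma orth_of_minimal {u w} :
  (forall t : R, `|u| ^+ 2 <= `|u - t *: w| ^+ 2) -> dot u w = 0.
Proof.
move=> umin; have [->|w0] := eqVneq w 0; first by rewrite dotC dot0l.
have ww : 0 < dot w w by exact: neq0_dnorm_gt0.
have := umin (dot u w / dot w w); rewrite sqr_normB normrZ exprMn real_normK ?num_real//.
rewrite dotZr (sqr_norm w); set a := dot u w.
have -> : `|u| ^+ 2 - 2 * (a / dot w w * a) + (a / dot w w) ^+ 2 * dot w w =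
          `|u| ^+ 2 - a ^+ 2 / dot w w by field; rewrite gt_eqF.
rewrite lerBrDl gerDr pmulr_lle0 ?invr_gt0// => a2.
by apply/eqP; rewrite -sqrf_eq0 eq_le a2 sqr_ge0.
Qed.

(** * Projection onto a finite span *)

Lemma lin_span_comb {n} (f : 'I_n -> V) (a : R) u v :
  lin_span f u -> lin_span f v -> lin_span f (a *: u + v).
Proof.
move=> [c ->] [c' ->]; exists (fun i => a * c i + c' i).
rewrite scaler_sumr -big_split; apply: eq_bigr => i _.
by rewrite scalerDl scalerA.
Qed.

Lemma lin_span0 {n} (f : 'I_n -> V) : lin_span f 0.
Proof. by exists (fun=> 0); rewrite big1 // => i _; rewrite scale0r. Qed.

Lemma lin_span_gen {n} (f : 'I_n -> V) i : lin_span f (f i).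
Proof.
exists (fun j => (j == i)%:R); rewrite (bigD1 i) //= eqxx scale1r big1 ?addr0 //.
by move=> j /negPf ->; rewrite scale0r.
Qed.

Lemma lin_span_sub {m n} (f : 'I_m -> V) (g : 'I_n -> V) :
  (forall i, exists j, f i = g j) -> lin_span f `<=` lin_span g.
Proof.
move=> fg _ [c ->].
apply: big_ind => [|u v Wu Wv|i _]; first exact: lin_span0.
  by rewrite -[u]scale1r; exact: lin_span_comb.
have [j ->] := fg i.
rewrite -[_ *: _]addr0; apply: lin_span_comb; last exact: lin_span0.
exact: lin_span_gen.
Qed.

Lemma orth_lin_span {n} (f : 'I_n -> V) u :
  (forall i, dot u (f i) = 0) -> forall w, lin_span f w -> dot u w = 0.
Proof.
move=> uf _ [c ->]; rewrite dot_sumr big1 // => i _.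
by rewrite dotZr uf mulr0.
Qed.

(** The coefficients of the projection solve the normal equations, whose
    matrix [A] is the Gram matrix of [f].  They are solvable because the right
    hand side [r] annihilates the kernel of [A]: if [A z = 0] then
    [z^T A z] is the squared norm of [\sum z_i f_i], so this vector is zero
    and so is its inner product with [v], which is [r z]. *)
Lemma proj_exists {n} (f : 'I_n -> V) v :
  exists p, lin_span f p /\ forall w, lin_span f w -> dot (v - p) w = 0.
Proof.
pose A : 'M[R]_n := \matrix_(i, j) dot (f i) (f j).
pose r : 'rV[R]_n := \row_j dot v (f j).
have rA : (r <= A)%MS.
  rewrite submxE; apply/eqP/matrixP => i0 k; rewrite ord1 !mxE.
  pose z i := cokermx A i k.
  have Az i : \sum_j dot (f i) (f j) * z j = 0.
    have /matrixP/(_ i k) := mulmx_coker A; rewrite !mxE; apply: etrans.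
    by apply: eq_bigr => j _; rewrite [A i j]mxE.
  have z0 : \sum_j z j *: f j = 0.
    apply: dot_eq0; rewrite dot_suml big1 // => i _; rewrite dotZl dot_sumr.
    rewrite (eq_bigr (fun j => dot (f i) (f j) * z j)) ?Az ?mulr0 // => j _.
    by rewrite dotZr mulrC.
  transitivity (dot (\sum_j z j *: f j) v); last by rewrite z0 dot0l.
  rewrite dot_suml; apply: eq_bigr => j _.
  by rewrite mxE dotZl dotC mulrC.
have [c rc] := submxP rA.
exists (\sum_i c 0 i *: f i); split; first by exists (c 0).
apply: orth_lin_span => j; rewrite dotBl dot_suml.
have /matrixP/(_ 0 j) := rc; rewrite !mxE => ->.
apply/eqP; rewrite subr_eq0; apply/eqP; apply: eq_bigr => i _.
by rewrite dotZl mxE.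
Qed.

Lemma orth_projP {n} (x : 'I_n -> X) v :
  sample_space V x (orth_proj (sample_space V x) v) /\
  forall w, sample_space V x w ->
    dot (v - orth_proj (sample_space V x) v) w = 0.
Proof. exact: getPex (proj_exists _ v). Qed.

(** Besides uniqueness, this is the way in which all projections below are
    computed: it is enough to exhibit a vector of the sample space with
    orthogonal residual. *)
Lemma orth_proj_unique {n} (x : 'I_n -> X) v p : sample_space V x p ->
  (forall w, sample_space V x w -> dot (v - p) w = 0) ->
  orth_proj (sample_space V x) v = p.
Proof.
move=> Wp vp; have [Wq vq] := orth_projP x v.
set q := orth_proj _ v in Wq vq *.
have Wqp : sample_space V x (q - p).
  by rewrite addrC -scaleN1r; exact: lin_span_comb.
apply/eqP; rewrite -subr_eq0; apply/eqP/dot_eq0.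
have -> : dot (q - p) (q - p) = dot (v - p) (q - p) - dot (v - q) (q - p).
  by rewrite -dotBl; congr (dot _ _); rewrite opprB [RHS]addrC addrA subrK.
by rewrite vp ?vq ?subrr.
Qed.

Lemma orth_proj_sum {n} (x : 'I_n -> X) {d} (c : 'I_d -> R) (b : 'I_d -> V) :
  orth_proj (sample_space V x) (\sum_j c j *: b j) =
  \sum_j c j *: orth_proj (sample_space V x) (b j).
Proof.
apply: orth_proj_unique.
  apply: big_ind => [|u v Wu Wv|j _]; first exact: lin_span0.
    by rewrite -[u]scale1r; exact: lin_span_comb.
  rewrite -[_ *: _]addr0; apply: lin_span_comb; last exact: lin_span0.
  by have [] := orth_projP x (b j).
move=> w Ww; rewrite -sumrB dot_suml big1 // => j _.
have [_ h] := orth_projP x (b j).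
by rewrite -scalerBr dotZl h // mulr0.
Qed.

Lemma sqr_norm_proj {n} (x : 'I_n -> X) v :
  `|v| ^+ 2 = `|orth_proj (sample_space V x) v| ^+ 2 +
              `|v - orth_proj (sample_space V x) v| ^+ 2.
Proof.
have [Wp vp] := orth_projP x v.
rewrite -sqr_normD_orth; last by rewrite dotC vp.
by rewrite [in RHS]addrC subrK.
Qed.

Lemma norm_proj_le {n} (x : 'I_n -> X) v :
  `|orth_proj (sample_space V x) v| <= `|v|.
Proof.
by rewrite -ler_sqr ?nnegrE // [leRHS](sqr_norm_proj x) lerDl sqr_ge0.
Qed.

Lemma proj_best {n} (x : 'I_n -> X) v w : sample_space V x w ->
  `|v - orth_proj (sample_space V x) v| ^+ 2 <= `|v - w| ^+ 2.
Proof.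
move=> Ww; have [Wp vp] := orth_projP x v; set p := orth_proj _ v in Wp vp *.
have -> : v - w = (v - p) + (p - w) by rewrite addrA subrK.
rewrite [leRHS]sqr_normD_orth ?lerDl ?sqr_ge0 //; apply: vp.
by rewrite addrC -scaleN1r; exact: lin_span_comb.
Qed.

(** * Density of the kernel sections *)

(** The parallelogram identity, in the form that makes minimizing sequences
    Cauchy: if the midpoint of [u] and [w] is at squared distance at least [D]
    from [v], and [u] and [w] are nearly at squared distance [D] from [v], then
    [u] and [w] are close to each other. *)
Lemma parallelogram v u w (D : R) : D <= `|v - 2^-1 *: (u + w)| ^+ 2 ->
  `|u - w| ^+ 2 <= 2 * (`|v - u| ^+ 2 - D) + 2 * (`|v - w| ^+ 2 - D).
Proof.
rewrite !sqr_normB !sqr_norm !(dotZl, dotZr, dotDl, dotDr) (dotC w u).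
lra.
Qed.

(** The projection theorem for the closure of a subspace [W]: a sequence in [W]
    minimizing the distance to [v] is Cauchy, its limit [p] minimizes the
    distance over [p + W], so that [v - p] is orthogonal to [W] and therefore
    zero; hence the sequence converges to [v]. *)
Lemma dense_of_trivial_orth W :
  W 0 -> (forall (a : R) u w, W u -> W w -> W (a *: u + w)) ->
  (forall u, (forall w, W w -> dot u w = 0) -> u = 0) ->
  forall v (e : R), 0 < e -> exists w, W w /\ `|v - w| ^+ 2 < e.
Proof.
move=> W0 Wcomb Worth v e e0.
have WZ a u : W u -> W (a *: u) by move=> Wu; rewrite -[_ *: _]addr0; exact: Wcomb.
have WD u w : W u -> W w -> W (u + w) by rewrite -{2}[u]scale1r; exact: Wcomb.
pose S := [set `|v - w| ^+ 2 | w in W].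
have Slb : lbound S 0 by move=> _ [w _ <-]; rewrite sqr_ge0.
have Sinf : has_inf S by split; [exists (`|v - 0| ^+ 2); exists 0 | exists 0].
have infS w : W w -> inf S <= `|v - w| ^+ 2.
  by move=> Ww; apply: ge_inf; [exists 0 | exists w].
have /choice[w wP] (n : nat) : exists w, W w /\ `|v - w| ^+ 2 < inf S + n.+1%:R^-1.
  have n0 : (0 : R) < n.+1%:R^-1 by rewrite invr_gt0.
  by have [_ [w Ww <-] vw] := inf_adherent n0 Sinf; exists w.
have Ww n : W (w n) by have [] := wP n.
have vw n : `|v - w n| ^+ 2 < inf S + n.+1%:R^-1 by have [] := wP n.
have inv0 (r : R) : 0 < r -> \forall n \near \oo, n.+1%:R^-1 < r.
  by move=> r0; exact: near_infty_natSinv_lt (PosNum r0).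
have /cauchy_cvgP wcvg : cauchy (w @ \oo).
  apply/cauchy_ballP => r r0; near_simpl.
  have r4 : 0 < r ^+ 2 / 4 by rewrite divr_gt0 ?exprn_gt0.
  near=> n m; rewrite -ball_normE /= -ltr_sqr ?nnegrE ?(ltW r0) //.
  apply: le_lt_trans (parallelogram _ _ _ (inf S) _) _.
    by apply: (infS); apply: WZ; apply: WD.
  have := vw n; have := vw m.
  have nr : n.+1%:R^-1 < r ^+ 2 / 4 by near: n; apply: inv0.
  have mr : m.+1%:R^-1 < r ^+ 2 / 4 by near: m; apply: inv0.
  have arith (D a c i j q : R) : i < q / 4 -> j < q / 4 -> c < D + j ->
    a < D + i -> 2 * (a - D) + 2 * (c - D) < q by lra.
  exact: arith nr mr.
set p := lim (w @ \oo) in wcvg.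
have vwcvg u : (fun n => `|v - w n - u| ^+ 2) @ \oo --> `|v - p - u| ^+ 2.
  have h : (fun n => `|v - w n - u|) @ \oo --> `|v - p - u|.
    apply: cvg_norm; apply: cvgB; last exact: cvg_cst.
    by apply: cvgB; [exact: cvg_cst | exact: wcvg].
  by rewrite expr2; apply: cvg_trans (cvgM h h).
have pmin u : W u -> `|v - p| ^+ 2 <= `|v - p - u| ^+ 2.
  move=> Wu.
  have cl := vwcvg 0; rewrite subr0 in cl.
  have cr : (fun n => `|v - w n - u| ^+ 2 + n.+1%:R^-1) @ \oo -->
      `|v - p - u| ^+ 2 + 0.
    by apply: cvgD; [exact: vwcvg | exact: cvg_harmonic].
  rewrite -[leRHS]addr0; apply: ler_cvg_to cl cr _.
  apply: nearW => n; rewrite subr0.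
  apply: le_trans (ltW (vw n)) _; rewrite lerD2r -addrA -opprD.
  by apply: infS; exact: WD.
have vp : v - p = 0.
  by apply: Worth => u Wu; apply: orth_of_minimal => t; apply: pmin; exact: WZ.
have := vwcvg 0; rewrite subr0 vp normr0 expr0n /=.
move=> /cvgr_lt /(_ e e0)[N _ /(_ N (leqnn N))]; rewrite /= subr0 => le.
by exists (w N).
Unshelve. all: by end_near.
Qed.

(** The points of all the samples, indexed by the pairs of a sample [f] and an
    index in it. *)
Lemma sample_join (F : finType) (n : F -> nat) (x : forall f, 'I_(n f) -> X) :
  exists N (y : 'I_N -> X),
    forall f, sample_space V (x f) `<=` sample_space V y.
Proof.
pose y (i : 'I_#|{: {f & 'I_(n f)}}|) := x (tag (enum_val i)) (tagged (enum_val i)).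
exists _, y => f; apply: lin_span_sub => i.
by exists (enum_rank (Tagged (fun f => 'I_(n f)) i)); rewrite /y enum_rankK.
Qed.

(** The union [W] of all sample spaces is a subspace because two samples can be
    merged, and its orthogonal complement is trivial because [(u, k(z, .))] is
    the value of [u] at [z] and an element is determined by its values. *)
Lemma sample_dense v (e : R) : 0 < e ->
  exists (s : {n & 'I_n -> X}) w, sample_space V (tagged s) w /\
    `|v - w| ^+ 2 < e.
Proof.
move=> e0.
pose W := [set w | exists s : {n & 'I_n -> X}, sample_space V (tagged s) w].
suff [w [[s sw] vw]] : exists w, W w /\ `|v - w| ^+ 2 < e by exists s, w.
apply: dense_of_trivial_orth e0.
- (* The merge of no samples: when X is empty there is no other sample. *)
  have [N [y _]] := sample_join void (fun=> 0%N) (fun f => match f with end).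
  by exists (existT _ N y); exact: lin_span0.
- move=> a u w [s su] [t tw].
  have [N [y yP]] := sample_join bool _ (fun i => tagged (if i then s else t)).
  exists (existT _ N y); apply: lin_span_comb.
    exact: (yP true).
  exact: (yP false).
- move=> u uW; apply: (@rkhs_eval_inj _ _ V); apply: funext => z.
  rewrite -!rkhs_reproducing dot0l; apply: uW.
  by exists (existT _ 1%N (fun=> z)); exact: (lin_span_gen _ ord0).
Qed.

(** * The stability constant as the inverse of a minimum *)

Lemma inve_le {a b : R} : 0 <= a -> a <= b -> (b%:E^-1 <= a%:E^-1)%E.
Proof.
move=> a0 ab; rewrite !inver; have [a00|an0] := eqVneq a 0; first exact: leey.
have a1 : 0 < a by rewrite lt_neqAle eq_sym an0.
have b1 := lt_le_trans a1 ab.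
by rewrite gt_eqF // lee_fin lef_pV2.
Qed.

(** The form in which the minimality of [m = |P v0|] over the unit sphere bounds
    the ratio [a / q] of an arbitrary [v], with [a = |v|] and [q = |P v|]; it
    includes the degenerate case [m = 0], where the bound is infinite. *)
Lemma div_le_inve {a m q : R} : 0 < a -> 0 <= m -> a * m <= q ->
  (a%:E / q%:E <= m%:E^-1)%E.
Proof.
move=> a0 m0 amq; rewrite !inver.
have [m00|mn0] := eqVneq m 0; first exact: leey.
have m1 : 0 < m by rewrite lt_neqAle eq_sym mn0.
have q1 : 0 < q by apply: lt_le_trans amq; rewrite mulr_gt0.
by rewrite gt_eqF // -EFinM lee_fin ler_pdivrMr // ler_pdivlMl // mulrC.
Qed.

Section OrthonormalBasis.
Context {d : nat} {Vd : set V} {b : 'I_d -> V} (hb : orthonormal_basis b Vd).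

Lemma sqr_norm_comb (c : 'I_d -> R) :
  `|\sum_j c j *: b j| ^+ 2 = \sum_j c j ^+ 2.
Proof.
rewrite sqr_norm dot_suml; apply: eq_bigr => j _; rewrite dotZl dot_sumr.
rewrite (bigD1 j) //= big1 ?addr0 => [|i /negPf ij].
  by rewrite dotZr hb.1 eqxx mulr1.
by rewrite dotZr hb.1 eq_sym ij mulr0.
Qed.

Lemma basis_norm j : `|b j| ^+ 2 = 1.
Proof. by rewrite sqr_norm hb.1 eqxx. Qed.

Lemma unit_sphere_compact :
  compact [set c : 'rV[R]_d | \sum_j c 0 j ^+ 2 = 1].
Proof.
apply: bounded_closed_compact.
  exists 1; split=> [|M M1 c /= c1]; first exact: num_real.
  apply: le_trans (ltW M1).
  rewrite /Num.norm /= mx_normrE; apply: bigmax_le => // -[i j] _ /=.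
  rewrite ord1 -[leRHS]normr1 -ler_sqr ?nnegrE ?normr_ge0 // !real_normK ?num_real //.
  by rewrite expr1n -c1 (bigD1 j) //= lerDl sumr_ge0 // => k _; rewrite sqr_ge0.
have -> : [set c : 'rV[R]_d | \sum_j c 0 j ^+ 2 = 1] =
          (fun c : 'rV[R]_d => \sum_j c 0 j ^+ 2) @^-1` [set 1] by [].
apply: closed_comp; last exact: closed_eq.
move=> c _; move: c; apply: continuous_big => [|j _]; first exact: add_continuous.
move=> c; have cj := @coord_continuous R 1 d 0 j c.
exact: (cvgM cj cj).
Qed.

Lemma norm_comb_continuous (f : 'I_d -> V) :
  continuous (fun c : 'rV[R]_d => `|\sum_j c 0 j *: f j|).
Proof.
move=> c; apply: continuous_comp; last exact: norm_continuous.
move: c; apply: continuous_big => [|j _]; first exact: add_continuous.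
move=> c; have cj := @coord_continuous R 1 d 0 j c.
exact: cvgZr_tmp cj.
Qed.

(** Existence of the maximum that defines [mu], by compactness of the unit
    sphere in coordinates.  The minimality inequality is stated for all [v] of
    [Vd], which is the homogeneous form of minimality on the sphere. *)
Lemma mu_minimizer (hd : (0 < d)%N) {n} (x : 'I_n -> X) :
  let P := orth_proj (sample_space V x) in
  exists v0, [/\ Vd v0, `|v0| = 1,
    forall v, Vd v -> `|v| * `|P v0| <= `|P v| &
    mu Vd x = ((`|P v0|)%:E^-1)%E].
Proof.
move=> P; pose vec (c : 'rV[R]_d) := \sum_j c 0 j *: b j.
have Pvec c : P (vec c) = \sum_j c 0 j *: P (b j) by exact: orth_proj_sum.
pose K := [set c : 'rV[R]_d | \sum_j c 0 j ^+ 2 = 1].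
have K0 : K !=set0.
  exists (delta_mx 0 (Ordinal hd)); rewrite /K /= (bigD1 (Ordinal hd)) //=.
  rewrite big1 ?addr0 => [|j /negPf jd]; rewrite mxE eqxx /= ?eqxx ?expr1n //.
  by rewrite jd expr0n.
have Pcont : {within K, continuous (fun c => `|P (vec c)|)}.
  apply: continuous_subspaceT.
  have -> : (fun c => `|P (vec c)|) = (fun c => `|\sum_j c 0 j *: P (b j)|).
    by apply: funext => c; rewrite Pvec.
  exact: norm_comb_continuous.
have [c0 /set_mem Kc0 c0min] := compact_EVT_min K0 unit_sphere_compact Pcont.
have Vd_vec c : Vd (vec c) by rewrite hb.2; exists (c 0).
have v01 : `|vec c0| = 1.
  by apply/eqP; rewrite -sqrp_eq1 // sqr_norm_comb; apply/eqP.
have v0min v : Vd v -> `|v| * `|P (vec c0)| <= `|P v|.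
  rewrite hb.2 => -[c vc].
  have [->|v_neq0] := eqVneq v 0; first by rewrite normr0 mul0r.
  have v_gt0 : 0 < `|v| by rewrite normr_gt0.
  pose c1 : 'rV[R]_d := \row_j (`|v|^-1 * c j).
  have vecc1 : vec c1 = `|v|^-1 *: v.
    rewrite vc scaler_sumr; apply: eq_bigr => j _.
    by rewrite mxE scalerA -vc.
  have Pvecc1 : P (vec c1) = `|v|^-1 *: P v.
    rewrite Pvec vc /P orth_proj_sum scaler_sumr; apply: eq_bigr => j _.
    by rewrite mxE scalerA -vc.
  have Kc1 : c1 \in K.
    apply/mem_set; rewrite /K /= -sqr_norm_comb -/(vec c1) vecc1 normrZ.
    by rewrite normfV normr_id mulVf ?expr1n // gt_eqF.
  have := c0min c1 Kc1; rewrite Pvecc1 normrZ normfV normr_id.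
  by rewrite ler_pdivlMl.
exists (vec c0); split=> //.
have v0_neq0 : vec c0 != 0 by rewrite -normr_eq0 v01 oner_eq0.
(* The ratios have m as a greatest element; get selects some greatest element,
   which equals m by antisymmetry. *)
set m := (_^-1)%E.
have max_m : (mu_ratios Vd x `&` ubound (mu_ratios Vd x)) m.
  split; first by exists (vec c0); rewrite // v01 mul1e.
  move=> _ [v [Vdv v0] <-]; apply: div_le_inve => //; last exact: v0min.
  by rewrite normr_gt0.
have [h1 h2] := getPex (ex_intro _ m max_m).
by apply/eqP; rewrite eq_le; apply/andP; split; [exact: max_m.2 | exact: h2 max_m.1].
Qed.

(** Cauchy-Schwarz for vector-valued families.  With [w] the combination on the
    left, the difference of the two sides is the sum of squares
    [\sum_j |f_j - c_j w|^2]: expanding it, the cross terms give [-2 |w|^2] and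
    the last ones [|w|^2], since [\sum_j c_j^2 = 1]. *)
Lemma sqr_norm_unit_comb_le (c : 'I_d -> R) (f : 'I_d -> V) :
  \sum_j c j ^+ 2 = 1 -> `|\sum_j c j *: f j| ^+ 2 <= \sum_j `|f j| ^+ 2.
Proof.
move=> c1; set w := \sum_j _.
rewrite -subr_ge0.
have -> : \sum_j `|f j| ^+ 2 - `|w| ^+ 2 = \sum_j `|f j - c j *: w| ^+ 2.
  transitivity (\sum_j (`|f j| ^+ 2 - 2 * (c j * dot (f j) w) +
                        c j ^+ 2 * `|w| ^+ 2)).
    rewrite big_split sumrB /= -mulr_sumr -mulr_suml c1 mul1r.
    have -> : \sum_j c j * dot (f j) w = `|w| ^+ 2.
      by rewrite sqr_norm [in RHS]/w dot_suml; apply: eq_bigr => j _; rewrite dotZl.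
    ring.
  apply: eq_bigr => j _; rewrite sqr_normB dotZr normrZ exprMn.
  by rewrite real_normK ?num_real.
by apply: sumr_ge0 => j _; rewrite sqr_ge0.
Qed.

(** By linearity, [v - P v] is the combination of the residuals of the basis
    with the coordinates of [v]; these have square sum 1. *)
Lemma sqr_norm_proj_ge {n} (x : 'I_n -> X) v : Vd v -> `|v| = 1 ->
  1 - \sum_j `|b j - orth_proj (sample_space V x) (b j)| ^+ 2 <=
  `|orth_proj (sample_space V x) v| ^+ 2.
Proof.
rewrite hb.2 => -[c vc] v1.
have c1 : \sum_j c j ^+ 2 = 1 by rewrite -sqr_norm_comb -vc v1 expr1n.
have := sqr_norm_proj x v; rewrite v1 expr1n => {1}->.
rewrite -addrA gerDl subr_le0.
rewrite [X in orth_proj _ X]vc {1}vc orth_proj_sum -sumrB.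
under eq_bigr do rewrite -scalerBr.
exact: sqr_norm_unit_comb_le.
Qed.

(** The inner products of the basis with the kernel sections form a [d x n]
    matrix, whose left kernel is nonzero when [n < d]; a kernel vector gives
    the coordinates of a [v] orthogonal to the sample space. *)
Lemma exists_proj_eq0 {n} (x : 'I_n -> X) : (n < d)%N ->
  exists v, [/\ Vd v, v != 0 & orth_proj (sample_space V x) v = 0].
Proof.
move=> nd; pose M : 'M[R]_(d, n) := \matrix_(j, i) dot (b j) (rkhs_ker V (x i)).
have : kermx M != 0.
  by rewrite -mxrank_eq0 mxrank_ker subn_eq0 -ltnNge (leq_ltn_trans (rank_leq_col M)).
case/rowV0Pn => c /sub_kermxP cM c0.
exists (\sum_j c 0 j *: b j); split.
- by rewrite hb.2; exists (c 0).
- apply: contra_neq c0 => v0; apply/rowP => j; rewrite mxE; apply/eqP.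
  rewrite -sqrf_eq0; apply/eqP.
  have : \sum_j c 0 j ^+ 2 = 0 by rewrite -sqr_norm_comb v0 normr0 expr0n.
  by move/psumr_eq0P; apply => // k _; rewrite sqr_ge0.
- apply: orth_proj_unique; first exact: lin_span0.
  apply: orth_lin_span => i; rewrite subr0 dot_suml.
  have /matrixP/(_ 0 i) := cM; rewrite !mxE; apply: etrans.
  by apply: eq_bigr => j _; rewrite dotZl [M j i]mxE.
Qed.

Lemma residual_gram {n} (x : 'I_n -> X) :
  \sum_(j < d) `|b j - orth_proj (sample_space V x) (b j)| ^+ 2 =
  \tr (1%:M - gram b x).
Proof.
apply: eq_bigr => j _; rewrite !mxE eqxx /=.
have [Pb bP] := orth_projP x (b j); set q := orth_proj _ _ in Pb bP *.
have := bP q Pb; rewrite dotBl => /eqP; rewrite subr_eq0 => /eqP bq.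
by rewrite sqr_normB basis_norm sqr_norm -bq (dotC q) mulr_natl mulr2n; ring.
Qed.

End OrthonormalBasis.

End Projection.

Theorem proposition8 (R : realType) (X : Type) (V : rkhs R X)
    (d : nat) (hd : (0 < d)%N) (Vd : set V) (b : 'I_d -> V)
    (hb : orthonormal_basis b Vd) :
  (forall (n : nat) (x : 'I_n -> X), (1 <= mu Vd x)%E) /\
  (forall (n : nat) (x : 'I_n -> X), (n < d)%N -> mu Vd x = +oo%E) /\
  (forall (n : nat) (x : 'I_n -> X),
      d%:R - 1 <= \tr (gram b x) ->
      (mu Vd x <=
        inv_sqrt (1 - \sum_(j < d)
          `|b j - orth_proj (sample_space V x) (b j)| ^+ 2)%R)%E /\
      inv_sqrt (1 - \sum_(j < d)
          `|b j - orth_proj (sample_space V x) (b j)| ^+ 2)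
        = inv_sqrt (1 - \tr (1%:M - gram b x))) /\
  (forall mustar : R, 1 < mustar ->
    exists (n : nat) (x : 'I_n -> X), (mu Vd x <= mustar%:E)%E).
Proof.
split=> [n x|]; last split=> [n x nd|]; last split=> [n x trG|mustar mustar1].
- have [v [_ v1 _ ->]] := mu_minimizer hb hd x.
  by rewrite -inve1; apply: inve_le => //; rewrite -v1 norm_proj_le.
- have [v [_ _ vmin ->]] := mu_minimizer hb hd x.
  have [u [Vdu u0 Pu0]] := exists_proj_eq0 hb x nd.
  have := vmin u Vdu; rewrite Pu0 normr0 pmulr_rle0 ?normr_gt0 // normr_le0.
  by move/eqP->; rewrite normr0 inve0.
- split; last by rewrite (residual_gram hb).
  have [v [Vdv v1 _ ->]] := mu_minimizer hb hd x.
  apply: inve_le; first exact: sqrtr_ge0.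
  rewrite -[leRHS]ger0_norm // -sqrtr_sqr ler_sqrt ?sqr_ge0 //.
  exact: (sqr_norm_proj_ge hb).
- (* d squared residuals below e sum up to at most 1 - mustar^-2, which bounds
     the squared minimum below by mustar^-2. *)
  pose e : R := (1 - mustar^-1 ^+ 2) / d%:R.
  have d0 : (0 : R) < d%:R by rewrite ltr0n.
  have mustar0 : 0 < mustar by exact: lt_trans mustar1.
  have e0 : 0 < e.
    by rewrite divr_gt0 // subr_gt0 expr_lt1 // ?invr_ge0 ?invf_lt1 // ltW.
  have [s sP] := choice (fun j => sample_dense (b j) e e0).
  have [N [y yP]] := sample_join (V := V) _ _ (fun j => tagged (s j)).
  exists N, y; have [v [Vdv v1 _ ->]] := mu_minimizer hb hd y.
  have -> : mustar%:E = (mustar^-1%:E^-1)%E.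
    by rewrite inver invr_eq0 gt_eqF // invrK.
  apply: inve_le; first by rewrite invr_ge0 ltW.
  rewrite -ler_sqr ?nnegrE ?invr_ge0 ?(ltW mustar0) //.
  apply: le_trans (sqr_norm_proj_ge hb y v Vdv v1).
  rewrite lerBrDl -lerBrDr.
  have -> : 1 - mustar^-1 ^+ 2 = \sum_(j < d) e.
    by rewrite sumr_const card_ord -[e *+ d]mulr_natr divfK // gt_eqF.
  apply: ler_sum => j _; have [w [sw bw]] := sP j.
  by apply: le_trans (ltW bw); apply: proj_best; exact: yP sw.
Qed.
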